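(* Suppose that $1\eqsim\alpha\ge\alpha_0$ and $\lambda^{-1}\eqsim\beta\ge\beta_0$. Let $(u,y,p)\in X_{\mathrm{ad}}\times Y\times Y^\star$ denote the unique solution of $$a(u,y,p;\,v-u,z-y,q-p)\ge\ell(v-u,z-y,q-p)\qquad\text{for all }(v,z,q)\in X_{\mathrm{ad}}\times Y\times Y^\star.$$ Let $X_{h,\mathrm{ad}}\subset X_{\mathrm{ad}}$ be a non-empty closed convex subset and let $Y_h\subset Y$, $Y_h^\star\subset Y^\star$ be closed subspaces. Set $W_h=X_{h,\mathrm{ad}}\times Y_h\times Y_h^\star$. If $(u_h,y_h,p_h)\in W_h$ denotes the solution of $$a(u_h,y_h,p_h;\,v-u_h,z-y_h,q-p_h)\ge\ell(v-u_h,z-y_h,q-p_h)\qquad\text{for all }(v,z,q)\in W_h,$$ then $$|\!|\!|(u-u_h,y-y_h,p-p_h)|\!|\!|_\lambda^2\lesssim\inf_{(v_h,z_h,q_h)\in W_h}\Big(|\!|\!|(u-v_h,y-z_h,p-q_h)|\!|\!|_\lambda^2+|(-\mathcal{B}^*\mathcal{I}^\star p+\lambda\mathcal{C}u,\,v_h-u)_X|\Big).$$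
   Context: All Hilbert spaces are real; $(\cdot,\cdot)_V$ and $\|\cdot\|_V$ denote the inner product and norm of a Hilbert space $V$. Let $H,X,Y,Y^\star$ be Hilbert spaces ($Y^\star$ is simply another Hilbert space, not necessarily the dual of $Y$), let $X_{\mathrm{ad}}\subseteq X$ be non-empty, closed and convex, and let $Z=\boldsymbol{L}^2(\Omega_1)\times\cdots\times\boldsymbol{L}^2(\Omega_n)$, where $\Omega_1,\dots,\Omega_n$ are Lipschitz domains and each $\boldsymbol{L}^2(\Omega_j)$ is a Lebesgue space of square-integrable scalar- or vector-valued functions. Let $\mathcal{A}\colon Z\to H$, $\mathcal{B}\colon X\to Z$, $\mathcal{C}\colon X\to X$ be bounded linear operators with (Hilbert space) adjoints $\mathcal{A}^*\colon H\to Z$, $\mathcal{B}^*\colon Z\to X$, where $\mathcal{C}=\mathcal{C}^*$ and there is $\kappa>0$ with $(\mathcal{C}u,u)_X\ge\kappa\|u\|_X^2$ for all $u\in X$. Let $\mathcal{L}\colon Y\to Z$ and $\mathcal{L}^\star\colon Y^\star\to Z$ be bounded linear bijections, and let $\mathcal{I}\colon Y\to Z$, $\mathcal{I}^\star\colon Y^\star\to Z$ be bounded linear operators with $(\mathcal{L}y,\mathcal{I}^\star p)_Z=(\mathcal{I}y,\mathcal{L}^\star p)_Z$ for all $y\in Y$, $p\in Y^\star$. Let $0<\lambda\le1$, $f\in Z$, $z_d\in H$. For $u\in X$, $y\in Y$ let $y_u\in Y$ and $p_y\in Y^\star$ be the unique solutions of $\mathcal{L}y_u=-\mathcal{B}u$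 and $\mathcal{L}^\star p_y=\mathcal{A}^*\mathcal{A}\mathcal{I}y$. Define the norm $$|\!|\!|(u,y,p)|\!|\!|_\lambda^2=\lambda\|u\|_X^2+\|y-y_u\|_Y^2+\lambda^{-1}\|p-p_y\|_{Y^\star}^2+\|\mathcal{A}\mathcal{I}y_u\|_H^2.$$ For constants $\alpha,\beta>0$ and $u,v\in X$, $y,z\in Y$, $p,q\in Y^\star$ define \begin{align*} a(u,y,p;v,z,q)&=\alpha(\mathcal{L}y+\mathcal{B}u,\mathcal{L}z+\mathcal{B}v)_Z+\beta(\mathcal{L}^\star p-\mathcal{A}^*\mathcal{A}\mathcal{I}y,\mathcal{L}^\star q-\mathcal{A}^*\mathcal{A}\mathcal{I}z)_Z+(-\mathcal{B}^*\mathcal{I}^\star p+\lambda\mathcal{C}u,v)_X,\\ \ell(v,z,q)&=\alpha(f,\mathcal{L}z+\mathcal{B}v)_Z+\beta(-\mathcal{A}^*z_d,\mathcal{L}^\star q-\mathcal{A}^*\mathcal{A}\mathcal{I}z)_Z. \end{align*} $A\lesssim B$ means $A\le C\,B$ with a constant $C>0$ independent of $\lambda\in(0,1]$, of the elements of the spaces and the data involved, and of the discrete sets $X_{h,\mathrm{ad}},Y_h,Y_h^\star$ (the underlying spaces and operators being fixed; $C$ may depend on the constants in $\alpha\eqsim1$, $\beta\eqsim\lambda^{-1}$); $A\eqsim B$ means $A\lesssim B\lesssim A$. Thresholds: $\alpha_0,\beta_0>0$ (possibly depending on $\lambda$) with $\alpha_0\eqsim1$, $\beta_0\eqsim\lambda^{-1}$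 are fixed such that for all $\alpha\ge\alpha_0$, $\beta\ge\beta_0$ and all $(u,y,p),(v,z,q)\in X\times Y\times Y^\star$ one has, with constants independent of $\lambda,\alpha,\beta$, $|\!|\!|(u,y,p)|\!|\!|_\lambda^2\lesssim a(u,y,p;u,y,p)$ and $|a(u,y,p;v,z,q)|\lesssim\max\{\alpha,\lambda\beta\}|\!|\!|(u,y,p)|\!|\!|_\lambda|\!|\!|(v,z,q)|\!|\!|_\lambda$; in particular the variational inequality for $a,\ell$ on any non-empty closed convex subset of $X\times Y\times Y^\star$ has a unique solution. *)

(* Defs.v *)
From HB Require Import structures.
From mathcomp Require Import all_boot all_order all_algebra.
From mathcomp Require Import all_classical all_reals all_analysis.

Set Implicit Arguments.
Unset Strict Implicit.
Unset Printing Implicit Defensive.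

Import Order.TTheory GRing.Theory Num.Theory.
Import numFieldNormedType.Exports.

Local Open Scope classical_set_scope.
Local Open Scope ring_scope.

(* Real Hilbert spaces: Banach spaces whose norm comes from an inner product. *)
HB.mixin Record CompleteNormedModule_isHilbert (R : realType) V
    & CompleteNormedModule R V := {
  inner : {dot V for (idfun : R -> R)} ;
  inner_norm : forall x : V, inner x x = `|x| ^+ 2
}.

#[short(type="hilbertType")]
HB.structure Definition Hilbert (R : realType) :=
  {V of CompleteNormedModule_isHilbert R V & CompleteNormedModule R V}.

Notation "''[' u , v ]" := (inner u v) : ring_scope.

(* Lebesgue measure on R^d, built on d-tuples by iterating the binary product
   measure and transporting along (x, t) |-> x :: t. The 0-fold product is the
   Dirac mass at the empty tuple. *)
Section lebesgue_tuple.
Context {R : realType}.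
Local Notation T d := (d.-tuple (measurableTypeR R)).

Definition consT d (x : measurableTypeR R * T d) : T d.+1 :=
  [the T d.+1 of x.1 :: x.2].

Section step.
Variables (d : nat) (mu : {sigma_finite_measure set (T d) -> \bar R}).

Lemma measurable_consT : measurable_fun setT (@consT d).
Proof. exact: measurable_cons. Qed.

Definition lebesgue_step : set (T d.+1) -> \bar R :=
  pushforward (lebesgue_measure \x mu)%E (@consT d).

Let lebesgue_step0 : lebesgue_step set0 = 0%E.
Proof. by rewrite /lebesgue_step /pushforward preimage_set0 measure0. Qed.

Let lebesgue_step_ge0 A : (0 <= lebesgue_step A)%E.
Proof. by rewrite /lebesgue_step /pushforward; exact: measure_ge0. Qed.

Let mpre (A : set (T d.+1)) : measurable A -> measurable (@consT d @^-1` A).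
Proof. by move=> mA; rewrite -[X in measurable X]setTI; exact: measurable_consT. Qed.

Let lebesgue_step_sigma_additive : semi_sigma_additive lebesgue_step.
Proof.
move=> F mF tF mUF; rewrite /lebesgue_step /pushforward preimage_bigcup.
apply: measure_semi_sigma_additive.
- by move=> n; exact: mpre.
- apply/trivIsetP => /= i j _ _ ij; rewrite -preimage_setI.
  by move/trivIsetP : tF => /(_ _ _ _ _ ij) ->//; rewrite preimage_set0.
- by rewrite -preimage_bigcup; exact: mpre.
Qed.

HB.instance Definition _ := isMeasure.Build _ _ _ lebesgue_step
  lebesgue_step0 lebesgue_step_ge0 lebesgue_step_sigma_additive.

Let lebesgue_step_sigma_finite : sigma_finite setT lebesgue_step.
Proof.
have /sigma_finiteP[F [FT ndF mF]] := sigma_finiteT (@lebesgue_measure R).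
have /sigma_finiteP[G [GT ndG mG]] := sigma_finiteT mu.
pose u (t : T d.+1) : measurableTypeR R * T d := (thead t, [tuple of behead t]).
have mu_u : measurable_fun setT u.
  apply: measurable_fun_pair; first exact: measurable_tnth.
  exact: measurable_behead.
have uK : cancel (@consT d) u.
  by case=> x t; congr pair; exact: val_inj.
exists (fun i => u @^-1` (F i `*` G i)).
  rewrite -preimage_bigcup; apply/esym/seteqP; split => // t _ /=.
  have [k _ Fk] : (\bigcup_i F i) (u t).1 by rewrite -FT.
  have [l _ Gl] : (\bigcup_i G i) (u t).2 by rewrite -GT.
  exists (maxn k l) => //; split.
  - by move: Fk; exact/subsetPset/ndF/leq_maxl.
  - by move: Gl; exact/subsetPset/ndG/leq_maxr.
move=> i; have [mFi Foo] := mF i; have [mGi Goo] := mG i; split.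
  by rewrite -[X in measurable X]setTI; apply: mu_u => //; exact: measurableX.
rewrite /lebesgue_step /pushforward -comp_preimage.
have -> : u \o @consT d = id by apply/funext => x /=; exact: uK.
by rewrite preimage_id product_measure1E// lte_mul_pinfty// ge0_fin_numE.
Qed.

HB.instance Definition _ := Measure_isSigmaFinite.Build _ _ _ lebesgue_step
  lebesgue_step_sigma_finite.
End step.

Fixpoint lebesgue_tuple d : {sigma_finite_measure set (T d) -> \bar R} :=
  if d is d'.+1 then lebesgue_step (lebesgue_tuple d') else \d_ [tuple].

End lebesgue_tuple.

Definition row_of_tuple {R : realType} {d : nat} (t : d.-tuple (measurableTypeR R)) :
  'rV[R]_d := \row_i tnth t i.

(* Lipschitz domain in R^(d+1): near each boundary point, and in a suitable
   orthonormal coordinate system [x *m Q], the set is the strict supergraph of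
   a Lipschitz function of the last d coordinates. The sup norm of 'rV is
   equivalent to the Euclidean one, so it gives the same notion of open set and
   of Lipschitz function. Boundedness is not required. *)
Definition lipschitz_domain (R : realType) d (Om : set 'rV[R]_d.+1) : Prop :=
  [/\ open Om, connected Om, Om !=set0 &
      forall x0, (closure Om `\` Om) x0 ->
        exists (Q : 'M[R]_d.+1) (gamma : 'rV[R]_d -> R) (k : R),
          [/\ Q *m Q^T = 1%:M, k.-lipschitz gamma &
              \forall x \near x0,
                Om x <-> gamma (col' ord0 (x *m Q)) < (x *m Q) ord0 ord0]].

Section L2.
Context {R : realType}.

Definition square_integrable d m (Om : set 'rV[R]_d)
    (g : 'rV[R]_d -> 'rV[R]_m) : Prop :=
  forall k : 'I_m,
    measurable_fun (row_of_tuple @^-1` Om)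
      (fun t => g (row_of_tuple t) ord0 k : measurableTypeR R) /\
    (lebesgue_tuple d).-integrable (row_of_tuple @^-1` Om)
      (fun t => ((g (row_of_tuple t) ord0 k) ^+ 2)%:E).

Definition ae_eq_on d m (Om : set 'rV[R]_d) (g h : 'rV[R]_d -> 'rV[R]_m) :
    Prop :=
  {ae lebesgue_tuple d, forall t,
    Om (row_of_tuple t) -> g (row_of_tuple t) = h (row_of_tuple t)}.

Definition L2_inner d m (Om : set 'rV[R]_d) (g h : 'rV[R]_d -> 'rV[R]_m) : R :=
  \int[lebesgue_tuple d]_(t in row_of_tuple @^-1` Om)
    \sum_(k < m) g (row_of_tuple t) ord0 k * h (row_of_tuple t) ord0 k.

(* [Z] is the Hilbert space L2(Om_0; R^(m_0)) x ... x L2(Om_(n-1); R^(m_(n-1)))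
   of tuples of a.e. classes; [rho z j] is a representative of the j-th
   component of [z]. Injectivity of z |-> (rho z j)_j modulo a.e. equality is a
   consequence of [L2_product_inner]. *)
Record L2_product (n : nat) (d m : 'I_n -> nat)
    (Om : forall j : 'I_n, set 'rV[R]_(d j).+1) (Z : hilbertType R)
    (rho : Z -> forall j : 'I_n, 'rV[R]_(d j).+1 -> 'rV[R]_(m j)) : Prop := {
  L2_product_mem : forall z j, square_integrable (Om j) (rho z j) ;
  L2_product_linear : forall (a : R) z w j,
    ae_eq_on (Om j) (rho (a *: z + w) j)
      (fun x => a *: rho z j x + rho w j x) ;
  L2_product_onto : forall g : (forall j : 'I_n, 'rV[R]_(d j).+1 -> 'rV[R]_(m j)),
    (forall j, square_integrable (Om j) (g j)) ->
    exists z, forall j, ae_eq_on (Om j) (rho z j) (g j) ;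
  L2_product_inner : forall z w,
    '[z, w] = \sum_(j < n) L2_inner (Om j) (rho z j) (rho w j)
}.
End L2.

Section operators.
Context {R : realType}.

Definition bounded_operator (U V : hilbertType R) (f : U -> V) : Prop :=
  exists M : R, forall x, `|f x| <= M * `|x|.

Definition adjoint (U V : hilbertType R) (f : U -> V) (g : V -> U) : Prop :=
  forall x y, '[f x, y] = '[x, g y].

Definition closed_convex_nonempty (V : hilbertType R) (A : set V) : Prop :=
  [/\ closed A, convex_set (A : set (convex_lmodType V)) & A !=set0].

Definition closed_subspace (V : hilbertType R) (A : set V) : Prop :=
  [/\ closed A, A 0 & forall (a : R) x y, A x -> A y -> A (a *: x + y)].

(* [opLs], [opIs] are the operators written with a star on Y*; [opAa], [opBa]
   are the Hilbert space adjoints of [opA], [opB]. *)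
Record operators (H X Y Ys Z : hilbertType R) := Operators {
  opA : {linear Z -> H} ;
  opAa : {linear H -> Z} ;
  opB : {linear X -> Z} ;
  opBa : {linear Z -> X} ;
  opC : {linear X -> X} ;
  opL : {linear Y -> Z} ;
  opLs : {linear Ys -> Z} ;
  opI : {linear Y -> Z} ;
  opIs : {linear Ys -> Z}
}.

Section problem.
Variables (H X Y Ys Z : hilbertType R) (P : operators H X Y Ys Z).
Local Notation A := (opA P).
Local Notation Aa := (opAa P).
Local Notation B := (opB P).
Local Notation Ba := (opBa P).
Local Notation C := (opC P).
Local Notation L := (opL P).
Local Notation Ls := (opLs P).
Local Notation I := (opI P).
Local Notation Is := (opIs P).

Record operator_assumptions : Prop := {
  opA_bounded : bounded_operator A ;
  opB_bounded : bounded_operator B ;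
  opC_bounded : bounded_operator C ;
  opL_bounded : bounded_operator L ;
  opLs_bounded : bounded_operator Ls ;
  opI_bounded : bounded_operator I ;
  opIs_bounded : bounded_operator Is ;
  opA_adjoint : adjoint A Aa ;
  opB_adjoint : adjoint B Ba ;
  opC_selfadjoint : adjoint C C ;
  opC_coercive : exists2 kappa : R, 0 < kappa &
    forall u, kappa * `|u| ^+ 2 <= '[C u, u] ;
  opL_bijective : bijective L ;
  opLs_bijective : bijective Ls ;
  opLI_compat : forall y p, '[L y, Is p] = '[I y, Ls p]
}.

(* When [L] and [Ls] are bijective these are the unique solutions; the default
   value 0 of [xget] is then irrelevant. *)
Definition y_of (u : X) : Y := xget 0 [set y | L y = - B u].
Definition p_of (y : Y) : Ys := xget 0 [set p | Ls p = Aa (A (I y))].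

Definition tnorm2 (lam : R) (w : X * Y * Ys) : R :=
  let: (u, y, p) := w in
  lam * `|u| ^+ 2 + `|y - y_of u| ^+ 2 + lam^-1 * `|p - p_of y| ^+ 2
  + `|A (I (y_of u))| ^+ 2.

Definition tnorm (lam : R) (w : X * Y * Ys) : R := Num.sqrt (tnorm2 lam w).

Definition aform (lam alpha beta : R) (w w' : X * Y * Ys) : R :=
  let: (u, y, p) := w in
  let: (v, z, q) := w' in
  alpha * '[L y + B u, L z + B v]
  + beta * '[Ls p - Aa (A (I y)), Ls q - Aa (A (I z))]
  + '[- Ba (Is p) + lam *: C u, v].

Definition lform (alpha beta : R) (f : Z) (zd : H) (w' : X * Y * Ys) : R :=
  let: (v, z, q) := w' in
  alpha * '[f, L z + B v] + beta * '[- Aa zd, Ls q - Aa (A (I z))].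

Definition VI_solution (lam alpha beta : R) (f : Z) (zd : H)
    (W : set (X * Y * Ys)) (w : X * Y * Ys) : Prop :=
  W w /\ forall w', W w' ->
    lform alpha beta f zd (w' - w) <= aform lam alpha beta w (w' - w).

(* [alpha0], [beta0] are functions of lambda. *)
Record admissible_thresholds (alpha0 beta0 : R -> R) : Prop := {
  alpha0_gt0 : forall lam, 0 < lam <= 1 -> 0 < alpha0 lam ;
  beta0_gt0 : forall lam, 0 < lam <= 1 -> 0 < beta0 lam ;
  alpha0_eqsim : exists c c' : R, [/\ 0 < c, 0 < c' &
    forall lam, 0 < lam <= 1 -> c <= alpha0 lam <= c'] ;
  beta0_eqsim : exists c c' : R, [/\ 0 < c, 0 < c' &
    forall lam, 0 < lam <= 1 -> c * lam^-1 <= beta0 lam <= c' * lam^-1] ;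
  aform_coercive : exists2 K : R, 0 < K &
    forall lam alpha beta, 0 < lam <= 1 ->
      alpha0 lam <= alpha -> beta0 lam <= beta ->
      forall w, tnorm2 lam w <= K * aform lam alpha beta w w ;
  aform_bounded : exists2 K : R, 0 < K &
    forall lam alpha beta, 0 < lam <= 1 ->
      alpha0 lam <= alpha -> beta0 lam <= beta ->
      forall w w', `|aform lam alpha beta w w'| <=
        K * (Num.max alpha (lam * beta) * tnorm lam w * tnorm lam w')
}.

End problem.
End operators.

(* Main.v *)
Require Import Defs.
From mathcomp Require Import all_boot all_order all_algebra.
From mathcomp Require Import all_classical all_reals all_analysis.
From mathcomp Require Import ring lra.

Set Implicit Arguments.
Unset Strict Implicit.
Unset Printing Implicit Defensive.

Import Order.TTheory GRing.Theory Num.Theory.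
Import numFieldNormedType.Exports.

Local Open Scope classical_set_scope.
Local Open Scope ring_scope.

(** The idea is that of the lemmas of Cea and Falk. Write [w] and [wh] for the
    solutions on [W = Xad x Y x Y*] and on its subset [Wh]. For [v] in [Wh],
    adding the two variational inequalities, tested with [wh] and with [v],
    gives [a(w - wh, w - wh) <= a(w - wh, w - v) + (a(w, v - w) - l(v - w))]
    ([falk_inequality]). Coercivity bounds the left-hand side from below by the
    squared norm of the error, and boundedness together with Young's inequality
    ([young_absorb]) absorbs the first term on the right.

    The remaining term is the residual of [w] at [v - w]. Since the state and
    the adjoint state are unconstrained in [W], and [L], [L*] are surjective,
    [w] solves the state and adjoint equations exactly
    ([VI_solution_adjoint_eq], [VI_solution_state_eq]). Both least-squares parts
    of the residual therefore vanish in every direction, and only the gradient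
    [-B* I* p + lambda C u], paired with the control component of [v - w], is
    left ([VI_solution_residual]). *)

(** Absorption form of Young's inequality. *)
Lemma young_absorb (R : realDomainType) (s t c r : R) :
  s ^+ 2 <= c * s * t + r -> s ^+ 2 <= c ^+ 2 * t ^+ 2 + r *+ 2.
Proof. by have := sqr_ge0 (s - c * t); nra. Qed.

Lemma le_mul_inf (R : realType) (S : set R) (k x : R) :
  0 < k -> S !=set0 -> (forall r, S r -> x <= k * r) -> x <= k * inf S.
Proof.
move=> k0 S0 xS; rewrite mulrC -ler_pdivrMr//.
by apply: lb_le_inf => // r /xS; rewrite ler_pdivrMr// mulrC.
Qed.

Lemma inner_self_le0 (R : realType) (V : hilbertType R) (x : V) :
  '[x, x] <= 0 -> x = 0.
Proof.
rewrite inner_norm => x0; apply/eqP; rewrite -normr_eq0 -sqrf_eq0.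
by rewrite eq_le x0 sqr_ge0.
Qed.

Section forms.
Context {R : realType} {H X Y Ys Z : hilbertType R}.
Variables (P : operators H X Y Ys Z) (lam alpha beta : R) (f : Z) (zd : H).
Local Notation A := (opA P).
Local Notation Aa := (opAa P).
Local Notation B := (opB P).
Local Notation Ba := (opBa P).
Local Notation C := (opC P).
Local Notation L := (opL P).
Local Notation Ls := (opLs P).
Local Notation I := (opI P).
Local Notation Is := (opIs P).
Local Notation a := (aform P lam alpha beta).
Local Notation ell := (lform P alpha beta f zd).
Implicit Types (w : X * Y * Ys) (W : set (X * Y * Ys)).

Lemma aformBl w1 w2 w : a (w1 - w2) w = a w1 w - a w2 w.
Proof.
case: w1 w2 w => [[u1 y1] p1] [[u2 y2] p2] [[u y] p] /=.
rewrite !linearB/= !linearDl/= !linearNl/=.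
ring.
Qed.

Lemma aformBr w w1 w2 : a w (w1 - w2) = a w w1 - a w w2.
Proof.
case: w1 w2 w => [[u1 y1] p1] [[u2 y2] p2] [[u y] p] /=.
rewrite !linearB/= !linearDr/= !linearNr/=.
ring.
Qed.

Lemma lformB w1 w2 : ell (w1 - w2) = ell w1 - ell w2.
Proof.
case: w1 w2 => [[u1 y1] p1] [[u2 y2] p2] /=.
rewrite !linearB/= !linearDr/= !linearNr/=.
ring.
Qed.

Lemma tnorm2_ge0 w : 0 < lam -> 0 <= tnorm2 P lam w.
Proof.
case: w => [[u y] p] lam0 /=.
by rewrite !addr_ge0// ?mulr_ge0// ?invr_ge0 ?ltW// sqr_ge0.
Qed.

(** The algebraic half of the error estimate: bilinearity and the inclusion of
    the discrete set suffice, without symmetry or coercivity of the form. *)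
Lemma falk_inequality W Wh w wh v :
  VI_solution P lam alpha beta f zd W w ->
  VI_solution P lam alpha beta f zd Wh wh ->
  Wh `<=` W -> Wh v ->
  a (w - wh) (w - wh) <= a (w - wh) (w - v) + (a w (v - w) - ell (v - w)).
Proof.
move=> [_ ws] [/[swap] whs Wwh] WhW /whs.
have := ws _ (WhW _ Wwh).
rewrite !aformBr !aformBl !lformB; lra.
Qed.

(** The residual splits into the least-squares residuals of the two equations
    and the gradient of the control. *)
Lemma residualE u y p v z q :
  a (u, y, p) (v, z, q) - ell (v, z, q) =
    alpha * '[L y + B u - f, L z + B v] +
    beta * '[Ls p - Aa (A (I y)) + Aa zd, Ls q - Aa (A (I z))] +
    '[- Ba (Is p) + lam *: C u, v].
Proof.
rewrite /=; move: (L y + B u) (Ls p - _) (- Ba _ + _) => r1 r2 g.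
move: (L z + B v) (Ls q - _) => t1 t2.
rewrite (linearDl _ t1) (linearDl _ t2) !linearNl/=.
ring.
Qed.

Section solution.
Variables (Xad : set X) (u : X) (y : Y) (p : Ys).
Hypothesis hP : operator_assumptions P.
Hypotheses (alpha_gt0 : 0 < alpha) (beta_gt0 : 0 < beta).
Hypothesis sol :
  VI_solution P lam alpha beta f zd (Xad `*` setT `*` setT) (u, y, p).

(** Only the control is constrained, so every direction [(0, z, q)] is admissible
    at the solution. *)
Lemma VI_solution_free_directions z q :
  0 <= alpha * '[L y + B u - f, L z] +
    beta * '[Ls p - Aa (A (I y)) + Aa zd, Ls q - Aa (A (I z))].
Proof.
case: sol => -[[Xu _] _] /(_ (u, y + z, p + q) (conj (conj Xu Logic.I) Logic.I)).
rewrite -[_ - (u, y, p)]/(u - u, y + z - y, p + q - p).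
rewrite subrr 2![_ + _ - _]addrAC 2!subrr 2!add0r.
by rewrite -subr_ge0 residualE linear0 addr0 linear0r addr0.
Qed.

Lemma VI_solution_adjoint_eq : Ls p - Aa (A (I y)) = - Aa zd.
Proof.
apply/eqP; rewrite -addr_eq0; apply/eqP/inner_self_le0.
have [Ls' _ LsK] := opLs_bijective hP.
have := VI_solution_free_directions 0 (Ls' (- (Ls p - Aa (A (I y)) + Aa zd))).
rewrite LsK (linear0 L) linear0r mulr0 add0r !linear0 addr0 linearNr.
by rewrite pmulr_rge0// oppr_ge0.
Qed.

Lemma VI_solution_state_eq : L y + B u = f.
Proof.
apply/eqP; rewrite -subr_eq0; apply/eqP/inner_self_le0.
have [L' _ LK] := opL_bijective hP.
have := VI_solution_free_directions (L' (- (L y + B u - f))) 0.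
rewrite LK VI_solution_adjoint_eq addNr linear0l mulr0 addr0 linearNr.
by rewrite pmulr_rge0// oppr_ge0.
Qed.

Lemma VI_solution_residual v z q :
  a (u, y, p) (v, z, q) - ell (v, z, q) = '[- Ba (Is p) + lam *: C u, v].
Proof.
rewrite residualE VI_solution_state_eq VI_solution_adjoint_eq subrr addNr.
by rewrite !linear0l !mulr0 !add0r.
Qed.

End solution.
End forms.

Theorem theorem7 (R : realType) (H X Y Ys Z : hilbertType R)
    (* Z is a product of Lebesgue spaces over Lipschitz domains *)
    (n : nat) (hn : (0 < n)%N) (d m : 'I_n -> nat)
    (hm : forall j, (0 < m j)%N)
    (Om : forall j : 'I_n, set 'rV[R]_(d j).+1)
    (hOm : forall j, lipschitz_domain (Om j))
    (rho : Z -> forall j : 'I_n, 'rV[R]_(d j).+1 -> 'rV[R]_(m j))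
    (hZ : L2_product Om rho)
    (P : operators H X Y Ys Z) (hP : operator_assumptions P)
    (alpha0 beta0 : R -> R) (h0 : admissible_thresholds P alpha0 beta0)
    (* the constants in alpha ~ 1 and beta ~ lambda^-1 *)
    (ca ca' cb cb' : R) (hca : 0 < ca) (hca' : 0 < ca')
    (hcb : 0 < cb) (hcb' : 0 < cb') :
  exists2 K : R, 0 < K &
    forall (Xad : set X), closed_convex_nonempty Xad ->
    forall (lam alpha beta : R), 0 < lam <= 1 ->
      ca <= alpha <= ca' -> alpha0 lam <= alpha ->
      cb * lam^-1 <= beta <= cb' * lam^-1 -> beta0 lam <= beta ->
    forall (f : Z) (zd : H) (u : X) (y : Y) (p : Ys),
      VI_solution P lam alpha beta f zd (Xad `*` setT `*` setT) (u, y, p) ->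
    forall (Xh : set X) (Yh : set Y) (Ysh : set Ys),
      Xh `<=` Xad -> closed_convex_nonempty Xh ->
      closed_subspace Yh -> closed_subspace Ysh ->
    forall (uh : X) (yh : Y) (ph : Ys),
      VI_solution P lam alpha beta f zd (Xh `*` Yh `*` Ysh) (uh, yh, ph) ->
      tnorm2 P lam (u - uh, y - yh, p - ph) <=
        K * inf [set r | exists v z q,
                   [/\ Xh v, Yh z, Ysh q &
                       r = tnorm2 P lam (u - v, y - z, p - q) +
                           `|'[- opBa P (opIs P p) + lam *: opC P u, v - u]|]].
Proof.
have [K1 K1_gt0 coer] := aform_coercive h0.
have [K2 K2_gt0 bound] := aform_bounded h0.
pose M := Num.max ca' cb'.
pose c := K1 * K2 * M.
have k_gt0 : 0 < c ^+ 2 + K1 *+ 2.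
  by apply: ltr_wpDl; rewrite ?sqr_ge0 ?pmulrn_lgt0.
exists (c ^+ 2 + K1 *+ 2) => //.
move=> Xad _ lam alpha beta lam01 /andP[caa aca] alpha0a /andP[cbb bcb] beta0b.
move=> f zd u y p sol Xh Yh Ysh XhX [_ _ [v0 Xv0]] [_ Yh0 _] [_ Ysh0 _].
move=> uh yh ph solh.
have /andP[lam_gt0 _] := lam01.
have alpha_gt0 : 0 < alpha by exact: lt_le_trans caa.
have beta_gt0 : 0 < beta by apply: lt_le_trans cbb; rewrite divr_gt0.
(* alpha ~ 1 and beta ~ 1 / lambda make the continuity constant uniform. *)
have max_le : Num.max alpha (lam * beta) <= M.
  rewrite ge_max /M !le_max aca/=; apply/orP; right.
  by rewrite mulrC -ler_pdivlMr.
apply: le_mul_inf => //.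
  by eexists; exists v0, 0, 0; split; [| | |reflexivity].
move=> _ [v [z [q [Xv Yz Ysq ->]]]].
have sub : Xh `*` Yh `*` Ysh `<=` Xad `*` setT `*` setT.
  by move=> [[? ?] ?] [[/= /XhX ? _] _].
have := falk_inequality sol solh sub (_ : (Xh `*` Yh `*` Ysh) (v, z, q)).
move=> /(_ (conj (conj Xv Yz) Ysq)).
rewrite (VI_solution_residual hP alpha_gt0 beta_gt0 sol).
set e := _ - (uh, _, _); set b := _ - (v, _, _); set g := '[_, _] => falk.
rewrite -[(u - uh, _, _)]/e -[(u - v, _, _)]/b.
have tnormK w : tnorm2 P lam w = tnorm P lam w ^+ 2.
  by rewrite /tnorm sqr_sqrtr// tnorm2_ge0.
have te0 : 0 <= tnorm P lam e by exact: sqrtr_ge0.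
have tb0 : 0 <= tnorm P lam b by exact: sqrtr_ge0.
have aeb : aform P lam alpha beta e b <= K2 * (M * tnorm P lam e * tnorm P lam b).
  apply: le_trans (ler_norm _) (le_trans (bound _ _ _ lam01 alpha0a beta0b e b) _).
  by rewrite ler_pM2l// ler_wpM2r// ler_wpM2r.
have est : tnorm P lam e ^+ 2 <=
    c * tnorm P lam e * tnorm P lam b + K1 * `|g|.
  rewrite -tnormK; apply: le_trans (coer _ _ _ lam01 alpha0a beta0b e) _.
  have -> : c * tnorm P lam e * tnorm P lam b + K1 * `|g| =
      K1 * (K2 * (M * tnorm P lam e * tnorm P lam b) + `|g|) by rewrite /c; ring.
  rewrite ler_pM2l//; apply: le_trans falk _.
  by rewrite lerD// ler_norm.
rewrite !tnormK; apply: le_trans (young_absorb est) _.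
rewrite -subr_ge0 [leRHS](_ : _ = c ^+ 2 * `|g| + K1 * tnorm P lam b ^+ 2 *+ 2).
  by rewrite addr_ge0 ?mulrn_wge0// mulr_ge0 ?sqr_ge0// ltW.
by ring.
Qed.
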